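(* Let $n \geq 2$ and let $\Lambda = \{0, \lambda_2, \ldots, \lambda_n\}$ be a multiset of real numbers with $\lambda_2, \ldots, \lambda_n$ positive. Then $\Lambda$ is Laplacian realizable for the complete graph $K_n$. Moreover, $K_n$ is the only connected graph on $n$ vertices for which every multiset $\Lambda$ of this form is Laplacian realizable.
   Context: Graphs are finite and simple. For a graph $G$ on $n$ vertices, $\mathcal{S}_L(G)$ denotes the set of $n\times n$ real symmetric matrices $A=[a_{i,j}]$ (generalized Laplacian matrices of $G$) such that $a_{i,j}<0$ if $\{i,j\}\in E(G)$, $a_{i,j}=0$ if $i\neq j$ and $\{i,j\}\notin E(G)$, and $a_{i,i}=-\sum_{k\neq i}a_{i,k}$ for all $i$. A multiset $\{0,\lambda_2,\ldots,\lambda_n\}$ of real numbers is Laplacian realizable for $G$ if there is $A\in\mathcal{S}_L(G)$ whose spectrum (multiset of eigenvalues) is $\{0,\lambda_2,\ldots,\lambda_n\}$. *)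

(* Defs.v *)
From mathcomp Require Import all_boot all_order all_algebra.
From mathcomp Require Import reals.
Set Implicit Arguments.
Unset Strict Implicit.
Unset Printing Implicit Defensive.
Import Order.TTheory GRing.Theory Num.Theory.
Local Open Scope ring_scope.

Record sgraph (n : nat) := SGraph {
  adj :> rel 'I_n;
  adj_sym : symmetric adj;
  adj_irrefl : irreflexive adj
}.

Definition neq_rel (n : nat) : rel 'I_n := fun i j => i != j.

Lemma neq_rel_sym n : symmetric (@neq_rel n).
Proof. by move=> i j; rewrite /neq_rel eq_sym. Qed.

Lemma neq_rel_irrefl n : irreflexive (@neq_rel n).
Proof. by move=> i; rewrite /neq_rel eqxx. Qed.

Definition complete_graph (n : nat) : sgraph n :=
  SGraph (@neq_rel_sym n) (@neq_rel_irrefl n).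

(* For n = 0 this holds vacuously. *)
Definition connected_graph (n : nat) (G : sgraph n) : Prop :=
  forall i j : 'I_n, connect G i j.

Definition generalized_laplacian (R : realType) (n : nat) (G : sgraph n)
    (A : 'M[R]_n) : Prop :=
  [/\ A^T = A,
      forall i j, G i j -> A i j < 0,
      forall i j, i != j -> ~~ G i j -> A i j = 0
    & forall i, A i i = - \sum_(k < n | k != i) A i k].

(* [s] lists the eigenvalues of [A] with multiplicity, in any order: multisets
   are represented by sequences, and the product does not depend on the order.
   This asserts in particular that all the eigenvalues lie in [R]. *)
Definition has_spectrum (R : realType) (n : nat) (A : 'M[R]_n) (s : seq R) :
    Prop :=
  char_poly A = \prod_(x <- s) ('X - x%:P).

Definition laplacian_realizable (R : realType) (n : nat) (G : sgraph n)
    (s : seq R) : Prop :=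
  exists2 A : 'M[R]_n, generalized_laplacian G A & has_spectrum A s.

(* Main.v *)
Require Import Defs.
From mathcomp Require Import all_boot all_order all_algebra.
From mathcomp Require Import reals.
Set Implicit Arguments.
Unset Strict Implicit.
Unset Printing Implicit Defensive.
Import Order.TTheory GRing.Theory Num.Theory.
Local Open Scope ring_scope.

(** Realizability over the complete graph is obtained by prescribing the
    eigenvectors.  Helmert's basis of [R^n] consists of the all-ones vector
    [v_0] and, for [0 < k < n], of
      [v_k = (1, .., 1, -k, 0, .., 0)]   with [k] leading ones;
    these vectors are pairwise orthogonal.  Attach the eigenvalue [mu_0 = 0] to
    [v_0] and the prescribed positive eigenvalues, in nonincreasing order
    [mu_1 >= .. >= mu_(n-1)], to the others.  The resulting matrix [A] is
    symmetric, has the right spectrum, and kills [v_0], so only the sign of an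
    off-diagonal entry, say at [i < j], has to be checked.  That entry is
    [\sum_k mu_k w_k] with [w_k = v_k(i) v_k(j) / |v_k|^2].  Since [\sum_k w_k]
    is the entry of the identity matrix at the same place, i.e. 0, it also
    equals [\sum_k (mu_k - mu_j) w_k]; there the term [k = 0] is negative, the
    terms [0 < k <= j] vanish, and the terms [k > j] are nonpositive because
    of the ordering ([helmert_conj_lt0]).

    For the converse, the single multiset [{0, 1, .., 1}] already forces every
    pair of vertices to be adjacent.  If [A] realizes it, Cayley-Hamilton shows
    that the symmetric matrix [A^2 - A] is nilpotent, hence zero.  With
    [K = J / n], [J] the all-ones matrix, [1 - A - K] is then a symmetric
    idempotent of trace 0, hence zero as well: [A = 1 - J / n] has no zero
    entry outside the diagonal ([laplacian_spectrum_0_1]).  Working with traces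
    of squares in this way replaces the spectral theorem. *)

(** * Similar matrices and symmetric nilpotent matrices *)

Lemma char_poly_conj (R : comNzRingType) (n : nat) (P Q A : 'M[R]_n) :
  P *m Q = 1%:M -> char_poly (P *m A *m Q) = char_poly A.
Proof.
move=> PQ1; rewrite /char_poly.
have -> : char_poly_mx (P *m A *m Q) =
    map_mx polyC P *m char_poly_mx A *m map_mx polyC Q.
  rewrite /char_poly_mx !map_mxM /= mulmxBr mulmxBl scalar_mxC -(mulmxA 'X%:M).
  by rewrite -[map_mx _ P *m map_mx _ Q]map_mxM PQ1 map_mx1 mulmx1.
rewrite !det_mulmx mulrAC -det_mulmx -map_mxM /= PQ1 map_mx1 det1.
by rewrite mul1r.
Qed.

(** The trace of [B^T *m B] is the sum of the squares of the entries of [B]. *)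
Lemma mxtrace_trmx_mul_eq0 (R : realDomainType) (m n : nat) (B : 'M[R]_(m, n)) :
  \tr (B^T *m B) = 0 -> B = 0.
Proof.
rewrite /mxtrace => trB0.
have sq_ge0 (j : 'I_n) : 0 <= (B^T *m B) j j.
  by rewrite mxE; apply: sumr_ge0 => i _; rewrite mxE -expr2 sqr_ge0.
apply/matrixP => i j; rewrite mxE.
have : (B^T *m B) j j = 0 by apply: (psumr_eq0P _ trB0).
rewrite mxE => /psumr_eq0P h.
have /eqP : B^T j i * B i j = 0.
  by apply: h => // k _; rewrite mxE -expr2 sqr_ge0.
by rewrite mxE mulf_eq0 orbb => /eqP.
Qed.

(** Raising the exponent to a power of two lets one undo squarings one at a
    time: for symmetric [B], [B ^+ 2 = B^T *m B] vanishes only if [B] does. *)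
Lemma symmetric_nilpotent_eq0 (R : realDomainType) (n : nat) (B : 'M[R]_n.+1)
    (k : nat) : B^T = B -> B ^+ k = 0 -> B = 0.
Proof.
move=> Bsym Bk0.
have {Bk0} : B ^+ (2 ^ k) = 0.
  by rewrite -(subnK (ltnW (ltn_expl k (ltnSn 1)))) exprD Bk0 mulr0.
elim: k B Bsym => [|k IHk] B Bsym; first by rewrite expn0 expr1.
rewrite expnS exprM => /IHk B2.
apply: mxtrace_trmx_mul_eq0; rewrite Bsym [B *m B]B2 ?mxtrace0 //.
by rewrite expr2 -[B * B]/(B *m B) trmx_mul Bsym.
Qed.

(** * The spectrum 0, 1, .., 1 determines the matrix *)

Lemma laplacian_mul_const1 (R : realType) (n : nat) (G : sgraph n)
    (A : 'M[R]_n) (p : nat) :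
  generalized_laplacian G A -> A *m (const_mx 1 : 'M_(n, p)) = 0.
Proof.
case=> _ _ _ diagA; apply/matrixP => i j; rewrite !mxE (bigD1 i) //=.
rewrite diagA !mxE mulr1 [X in _ + X](eq_bigr (fun k => A i k)) ?addNr // => k _.
by rewrite mxE mulr1.
Qed.

Lemma has_spectrum_trace (R : realType) (n : nat) (A : 'M[R]_n) (s : seq R) :
  (0 < n)%N -> has_spectrum A s -> \tr A = \sum_(x <- s) x.
Proof.
move=> n_gt0 specA.
have size_s : size s = n.
  by apply: succn_inj; rewrite -(size_char_poly A) specA size_prod_XsubC.
apply: oppr_inj; rewrite -char_poly_trace // specA -size_s.
by rewrite coefPn_prod_XsubC // size_s -lt0n.
Qed.

(** [A] must be the orthogonal projection onto the complement of the all-ones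
    vector, since its eigenvalues are 0 and 1 and its kernel is a line
    containing that vector.  The proof shows that the symmetric matrix
    [F = 1 - A - J / n] is idempotent, so that
    [\tr (F^T *m F) = \tr F = n - (n - 1) - 1 = 0]. *)
Lemma laplacian_spectrum_0_1 (R : realType) (n : nat) (G : sgraph n)
    (A : 'M[R]_n) : (0 < n)%N ->
  generalized_laplacian G A -> has_spectrum A (0 :: nseq n.-1 1) ->
  A = 1%:M - n%:R^-1 *: const_mx 1.
Proof.
case: n G A => // n G A _ lapA specA.
have [Asym _ _ _] := lapA.
have n0 : n.+1%:R != 0 :> R by rewrite pnatr_eq0.
have idemA : A *m A = A.
  apply/eqP; rewrite -subr_eq0; apply/eqP.
  apply: (@symmetric_nilpotent_eq0 _ _ _ n.+1).
    by rewrite linearB /= trmx_mul Asym.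
  have CH := Cayley_Hamilton A.
  rewrite specA big_cons big_nseq /= in CH.
  rewrite iter_mulr_1 subr0 rmorphM rmorphXn rmorphB /= in CH.
  rewrite horner_mx_X horner_mx_C in CH.
  (* A (A - 1) ^+ n = 0, where n + 1 is the size of A; the exponent n + 1 on
     both commuting factors of A^2 - A covers this. *)
  have -> : A *m A - A = A * (A - 1) by rewrite mulrBr mulr1.
  rewrite exprMn_comm; last by apply/commrB => //; apply: commr1.
  by rewrite exprSr [(A - 1) ^+ n.+1]exprSr -mulrA [A * (_ * _)]mulrA CH mul0r mulr0.
set K : 'M[R]_n.+1 := n.+1%:R^-1 *: const_mx 1.
have AK0 : A *m K = 0 by rewrite -scalemxAr (laplacian_mul_const1 _ lapA) scaler0.
have Ksym : K^T = K by rewrite linearZ /= trmx_const.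
have KA0 : K *m A = 0 by rewrite -[LHS]trmxK trmx_mul Ksym Asym AK0 trmx0.
have idemK : K *m K = K.
  rewrite -scalemxAl -scalemxAr; congr (_ *: _); apply/matrixP => i j.
  rewrite !mxE (eq_bigr (fun=> 1)) => [|k _]; last by rewrite !mxE mulr1.
  by rewrite sumr_const card_ord mulVf.
have trK : \tr K = 1.
  by rewrite mxtraceZ /mxtrace (eq_bigr (fun=> 1)) => [|i _];
    rewrite ?mxE // sumr_const card_ord mulVf.
have trA : \tr A = n%:R.
  by rewrite (has_spectrum_trace _ specA) // big_cons add0r big_nseq iter_addr_0.
apply/eqP; rewrite -subr_eq0 -oppr_eq0; apply/eqP.
set F := - _; have defF : F = 1%:M - A - K by rewrite /F opprB addrAC.
apply: mxtrace_trmx_mul_eq0.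
have -> : F^T = F by rewrite defF !linearB /= trmx1 Asym Ksym.
have -> : F *m F = F.
  have FA0 : F *m A = 0 by rewrite defF !mulmxBl mul1mx idemA KA0 !subrr.
  have FK0 : F *m K = 0 by rewrite defF !mulmxBl mul1mx AK0 idemK subr0 subrr.
  by rewrite [X in _ *m X]defF !mulmxBr mulmx1 FA0 FK0 !subr0.
by rewrite defF !linearB /= mxtrace1 trA trK -natr1 addrAC addrK subrr.
Qed.

(** * Helmert's orthogonal basis *)

(** The [i]-th coordinate of the [k]-th basis vector.  It does not depend on the
    dimension, which only bounds [i] and [k]. *)
Definition helmert (R : pzRingType) (k i : nat) : R :=
  if (k == 0)%N || (i < k)%N then 1 else if i == k then - k%:R else 0.

Lemma helmert0l (R : pzRingType) i : helmert R 0 i = 1.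
Proof. by []. Qed.

Lemma helmert0r (R : pzRingType) k : helmert R k 0 = 1.
Proof. by case: k. Qed.

Lemma helmert_lt (R : pzRingType) k i : (i < k)%N -> helmert R k i = 1.
Proof. by move=> ik; rewrite /helmert ik orbT. Qed.

Lemma helmert_gt (R : pzRingType) k i :
  (0 < k < i)%N -> helmert R k i = 0.
Proof.
by case/andP=> k0 ki; rewrite /helmert gtn_eqF //= ltnNge ltnW //= gtn_eqF.
Qed.

Lemma sum_helmert (R : pzRingType) n k :
  (0 < k < n)%N -> \sum_(i < n) helmert R k i = 0.
Proof.
case/andP=> k0 kn; rewrite -(subnKC kn) big_split_ord /= big_ord_recr /=.
rewrite [X in X + _ + _](eq_bigr (fun=> 1)) => [|i _]; last exact: helmert_lt.
rewrite sumr_const card_ord [helmert R k k]/helmert ltnn orbF gtn_eqF // eqxx.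
rewrite subrr add0r big1 // => i _.
by rewrite helmert_gt // k0 addSn ltnS leq_addr.
Qed.

(** Of two distinct basis vectors, one is constantly 1 on the support of the
    other, so their inner product is the coordinate sum of the latter. *)
Lemma helmert_orthogonal (R : pzRingType) n k l :
  (k < n)%N -> (l < n)%N -> k != l ->
  \sum_(i < n) helmert R k i * helmert R l i = 0.
Proof.
(* k' indexes the vector of smaller support, l' the one that is 1 there: either
   the all-ones vector (l' = 0) or a later one. *)
suff main k' l' : (0 < k' < n)%N -> (l' == 0%N) || (k' < l')%N ->
    \sum_(i < n) helmert R k' i * helmert R l' i = 0 /\
    \sum_(i < n) helmert R l' i * helmert R k' i = 0.
  move=> kn ln; have [->|k0] := posnP k.
    by rewrite eq_sym -lt0n => l0; have [] := main l 0%N; rewrite ?l0 ?ln.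
  have [->|l0] := posnP l; first by have [] := main k 0%N; rewrite ?k0 ?kn.
  by case: ltngtP => // kl _; [have [] := main k l | have [] := main l k];
    rewrite ?k0 ?l0 ?kl ?orbT.
move=> k0n l'k'.
have l'1 (i : nat) : (i <= k')%N -> helmert R l' i = 1.
  move=> ik; case/orP: l'k' => [/eqP-> //|kl]; apply: helmert_lt.
  exact: leq_ltn_trans kl.
have k'0 (i : nat) : (k' < i)%N -> helmert R k' i = 0.
  by move=> ik; case/andP: k0n => k0 _; rewrite helmert_gt ?k0.
split; rewrite -[RHS](sum_helmert R k0n); apply: eq_bigr => i _.
  by case: (leqP i k') => [/l'1-> | /k'0->]; rewrite ?mulr1 ?mul0r.
by case: (leqP i k') => [/l'1-> | /k'0->]; rewrite ?mul1r ?mulr0.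
Qed.

(** * Matrices diagonal in Helmert's basis *)

Section HelmertMatrix.
Variables (R : realFieldType) (n : nat).

Definition helmert_mx : 'M[R]_n.+1 := \matrix_(i, k) helmert R k i.

Definition helmert_sqnorm (k : nat) : R := \sum_(i < n.+1) helmert R k i ^+ 2.

(** Orthogonality makes the transpose an inverse up to rescaling by the squared
    lengths; keeping the basis unnormalized avoids square roots. *)
Definition helmert_inv : 'M[R]_n.+1 :=
  \matrix_(k, i) (helmert R k i / helmert_sqnorm k).

Lemma helmert_sqnorm_gt0 k : 0 < helmert_sqnorm k.
Proof.
rewrite /helmert_sqnorm big_ord_recl helmert0r expr1n ltr_pwDl // sumr_ge0 //.
by move=> i _; rewrite sqr_ge0.
Qed.

Lemma helmert_mxK : helmert_inv *m helmert_mx = 1%:M.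
Proof.
apply/matrixP => k l; rewrite !mxE.
rewrite (eq_bigr (fun i : 'I__ =>
    (helmert_sqnorm k)^-1 * (helmert R k i * helmert R l i))); last first.
  by move=> i _; rewrite !mxE mulrAC mulrC.
rewrite -mulr_sumr; have [<-|kl] := eqVneq k l.
  under eq_bigr do rewrite -expr2.
  by rewrite mulVf // gt_eqF ?helmert_sqnorm_gt0.
by rewrite helmert_orthogonal ?mulr0.
Qed.

Lemma helmert_mxKV : helmert_mx *m helmert_inv = 1%:M.
Proof. exact/mulmx1C/helmert_mxK. Qed.

Definition helmert_conj (mu : nat -> R) : 'M[R]_n.+1 :=
  helmert_mx *m diag_mx (\row_k mu k) *m helmert_inv.

(** The spectral decomposition: a combination of rank-one projections. *)
Lemma helmert_conjE mu i j : helmert_conj mu i j =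
  \sum_(k < n.+1) mu k * (helmert R k i * helmert R k j / helmert_sqnorm k).
Proof.
rewrite mxE; apply: eq_bigr => k _; rewrite mul_mx_diag !mxE.
by rewrite [_ * mu k]mulrC !mulrA.
Qed.

Lemma helmert_conj_sym mu : (helmert_conj mu)^T = helmert_conj mu.
Proof.
apply/matrixP => i j; rewrite mxE !helmert_conjE; apply: eq_bigr => k _.
by rewrite [helmert R k j * _]mulrC.
Qed.

Lemma char_poly_helmert_conj mu :
  char_poly (helmert_conj mu) = \prod_(k < n.+1) ('X - (mu k)%:P).
Proof.
rewrite char_poly_conj ?helmert_mxKV // char_poly_trig.
  by apply: eq_bigr => k _; rewrite !mxE eqxx.
by apply/is_trig_mxP => i j ij; rewrite mxE -val_eqE /= ltn_eqF ?mulr0n.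
Qed.

(** The row sums are the coordinates of the image of the all-ones vector, whose
    eigenvalue is [mu 0]. *)
Lemma sum_helmert_conj mu i : mu 0%N = 0 -> \sum_j helmert_conj mu i j = 0.
Proof.
move=> mu0; under eq_bigr do rewrite helmert_conjE.
rewrite exchange_big /= big1 // => k _; rewrite -mulr_sumr.
have [->|k0] := posnP k; first by rewrite mu0 mul0r.
by rewrite -mulr_suml -mulr_sumr sum_helmert ?k0 ?ltn_ord // mulr0 mul0r mulr0.
Qed.

(** The place where the order of the eigenvalues matters.  Subtracting
    [mu j *: 1%:M] does not change the entry at [(i, j)].  It
    cancels the [j]-th eigenvector, the only one with coordinates of opposite
    signs at [i < j], and leaves nonpositive coefficients on the other ones that
    do not vanish at [j], namely the [0]-th and the later ones. *)
Lemma helmert_conj_lt0 mu (i j : 'I_n.+1) :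
  mu 0%N = 0 -> 0 < mu j ->
  (forall k : nat, (j < k < n.+1)%N -> mu k <= mu j) ->
  (i < j)%N -> helmert_conj mu i j < 0.
Proof.
move=> mu0 muj_gt0 mu_le ij.
have -> : helmert_conj mu i j = \sum_(k < n.+1)
    (mu k - mu j) * (helmert R k i * helmert R k j / helmert_sqnorm k).
  under [RHS]eq_bigr do rewrite mulrBl.
  rewrite big_split sumrN /= -mulr_sumr -helmert_conjE.
  have /matrixP/(_ i j) := helmert_mxKV; rewrite !mxE -val_eqE /= ltn_eqF //.
  under eq_bigr do rewrite !mxE mulrA.
  by move->; rewrite mulr0 subr0.
rewrite big_ord_recl mu0 !helmert0l mulr1 sub0r mul1r mulNr.
(* The all-ones vector contributes - mu j / (n + 1), which makes the bound strict. *)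
apply: ltr_nwDl.
  by rewrite oppr_lt0 mulr_gt0 ?invr_gt0 ?helmert_sqnorm_gt0.
apply: sumr_le0 => k _.
have := lift0 k; move: (lift _ _) => l def_l.
have {k def_l} l0 : (0 < l)%N by rewrite def_l.
have [jl|lj|->] := ltngtP j l; last by rewrite subrr mul0r.
  rewrite !helmert_lt ?(ltn_trans ij) // !mul1r.
  rewrite mulr_le0_ge0 ?subr_le0 ?mu_le ?jl ?ltn_ord //.
  by rewrite invr_ge0 ltW ?helmert_sqnorm_gt0.
by rewrite [helmert R l j]helmert_gt ?l0 // mulr0 mul0r mulr0.
Qed.

End HelmertMatrix.

(** * Realizability and complete graphs *)

Lemma complete_graph_realizable (R : realType) (n : nat) (s : seq R) :
  size s = n -> {in s, forall x, 0 < x} ->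
  laplacian_realizable (complete_graph n.+1) (0 :: s).
Proof.
move=> size_s s_gt0; pose t := sort >=%R s; pose mu := nth 0 (0 :: t).
have size_t : size t = n by rewrite size_sort.
have mu_gt0 (j : nat) : (0 < j < n.+1)%N -> 0 < mu j.
  case: j => // j jn; apply: s_gt0.
  by rewrite -(mem_sort >=%R) /mu /= mem_nth // size_t.
have mu_le (j k : nat) : (0 < j)%N -> (j < k < n.+1)%N -> mu k <= mu j.
  case: j k => // j [|k] // _ /andP[jk kn]; rewrite /mu /=.
  apply: (@sorted_leq_nth _ >=%R) => //; last exact: ltnW.
  - by move=> x y z xy /le_trans; apply.
  - by move=> x; apply: lexx.
  - by apply: (@sort_sorted _ >=%R) => x y; apply: le_total.
  - by rewrite inE size_t; apply: (ltn_trans jk kn).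
  - by rewrite inE size_t.
exists (helmert_conj n mu); last first.
  rewrite /has_spectrum char_poly_helmert_conj big_ord_recl big_cons.
  congr (_ * _); rewrite [RHS](perm_big t) ?(perm_sym s) ?perm_sort //=.
  by rewrite [RHS](big_nth 0) size_t big_mkord; apply: eq_bigr.
have lt0 (i j : 'I_n.+1) : (i < j)%N -> helmert_conj n mu i j < 0.
  move=> ij; have j0 : (0 < j)%N by apply: leq_trans ij.
  by apply: helmert_conj_lt0 => //; [apply: mu_gt0; rewrite j0 /= | move=> k; apply: mu_le].
split.
- exact: helmert_conj_sym.
- move=> i j; rewrite /= /neq_rel -val_eqE neq_ltn => /orP[/lt0 //|/lt0].
  by have /matrixP/(_ i j) := helmert_conj_sym n mu; rewrite [LHS]mxE => ->.
- by move=> i j ij; rewrite /= /neq_rel ij.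
move=> i; apply/eqP; rewrite -addr_eq0; apply/eqP.
by rewrite -[RHS](@sum_helmert_conj _ n mu i) // [RHS](bigD1 i).
Qed.

Theorem theorem2p5 (R : realType) (n : nat) (hn : (2 <= n)%N) :
  (forall lam : (n.-1).-tuple R, (forall i, 0 < tnth lam i) ->
     laplacian_realizable (complete_graph n) (0 :: lam)) /\
  (forall G : sgraph n,
     (connected_graph G /\
      (forall lam : (n.-1).-tuple R, (forall i, 0 < tnth lam i) ->
         laplacian_realizable G (0 :: lam))) <->
     G =2 complete_graph n).
Proof.
have n_gt0 : (0 < n)%N by apply: ltnW.
have realK (lam : (n.-1).-tuple R) : (forall i, 0 < tnth lam i) ->
    laplacian_realizable (complete_graph n) (0 :: lam).
  case: n n_gt0 {hn} lam => // n _ lam lam_gt0.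
  apply: complete_graph_realizable; first exact: size_tuple.
  by move=> x /tnthP[i ->].
split=> // G; split=> [[_ realG] i j | GK].
  (* All the nonzero eigenvalues are taken equal: a missing edge would be a zero
     entry of the forced matrix 1 - J / n. *)
  have [A lapA specA] : laplacian_realizable G (0 :: nseq n.-1 (1 : R)).
    by apply: (realG (nseq_tuple n.-1 1)) => k; rewrite tnth_nseq ltr01.
  rewrite /= /neq_rel; have [->|ij] := eqVneq i j; first exact: adj_irrefl.
  have [_ _ A0 _] := lapA.
  apply: contraT => /(A0 _ _ ij)/eqP.
  rewrite (laplacian_spectrum_0_1 n_gt0 lapA specA) !mxE (negPf ij) sub0r mulr1.
  by rewrite oppr_eq0 invr_eq0 pnatr_eq0 -leqn0 leqNgt n_gt0.
split=> [i j | lam /realK[A [Asym Aneg A0 Adiag] specA]].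
  have [->|ij] := eqVneq i j; first exact: connect0.
  by apply: connect1; rewrite GK.
by exists A => //; split=> // i j; rewrite GK; [apply: Aneg | apply: A0].
Qed.
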